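(* Let $n\ge 9$ be an odd integer and let $I=\{2,3,\ldots,\frac{n-1}{2}-2\}$. If the merged Johnson graph $J(n,\frac{n-1}{2})_I$ is a core, then so is $3\text{-}AUQI(n,2)$.
   Context: $[n]=\{1,\dots,n\}$. A hypergraph $H=(V,E)$ consists of a finite set $V$ of vertices and a set $E$ of non-empty subsets of $V$ (hyperedges) whose union is $V$. A homomorphism $f:H\to H_1$ from $H=(V,E)$ to $H_1=(V_1,E_1)$ is a map $f:V\to V_1$ such that for every $e\in E$ there is $e'\in E_1$ with $f(e)\subseteq e'$ and $|f(e)|=|e|$ (for graphs: the usual graph homomorphisms). An endomorphism is a homomorphism $H\to H$; an automorphism is a bijective endomorphism. A hypergraph (or graph) is a core if every endomorphism of it is an automorphism. Definition of $3\text{-}QI(n,2)$ (for $n\ge 8$): its vertices are all binary strings of length $n$ with entries in $\{0,1\}$ whose first entry is $0$ and in which each symbol occurs at least $4$ times; equivalently, the unordered partitions $\{A,\overline{A}\}$ of $[n]$ with $|A|,|\overline{A}|\ge 4$. Three vertices $v_1,v_2,v_3$ form a hyperedge if and only if for every $(g_1,g_2,g_3)\in\{0,1\}^3$ there is an index $j$ with $v_i[j]=g_i$ for $i=1,2,3$ (equivalently, all eight triple intersections of parts, one part from each partition, are non-empty). For $n$ odd, $3\text{-}AUQI(n,2)$ is the subhypergraph of $3\text{-}QI(n,2)$ induced on the vertices in which one symbol occurs $\frac{n-1}{2}$ times and the other $\frac{n+1}{2}$ times (its hyperedges are all hyperedges of $3\text{-}QI(n,2)$ contained in this vertex set). The merged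 Johnson graph $J(n,m)_I$ has as vertices all $m$-subsets of $[n]$, with $M,M'$ adjacent iff $|M\cap M'|\in I$. *)

(* Defs.v *)
From mathcomp Require Import all_boot.

Set Implicit Arguments.
Unset Strict Implicit.
Unset Printing Implicit Defensive.

(* A hypergraph on the vertex set T is given by its set E of hyperedges. The  *)
(* two well-formedness conditions are kept as a separate predicate, because   *)
(* an induced subhypergraph need not satisfy the second one.                  *)
Definition is_hypergraph (T : finType) (E : {set {set T}}) : Prop :=
  set0 \notin E /\ cover E = [set: T].

Definition hypergraph_hom (T T1 : finType) (E : {set {set T}})
    (E1 : {set {set T1}}) (f : T -> T1) : Prop :=
  forall e, e \in E ->
    exists e', [/\ e' \in E1, f @: e \subset e' & #|f @: e| = #|e| ].

Definition hypergraph_aut (T : finType) (E : {set {set T}}) (f : T -> T) :=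
  hypergraph_hom E E f /\ bijective f.

Definition hypergraph_core (T : finType) (E : {set {set T}}) : Prop :=
  forall f : T -> T, hypergraph_hom E E f -> hypergraph_aut E f.

Definition induced_edges (T : finType) (E : {set {set T}}) (U : pred T) :
    {set {set {x : T | U x}}} :=
  [set e : {set {x : T | U x}} | val @: e \in E].

Definition graph_hom (T T1 : finType) (adj : rel T) (adj1 : rel T1)
    (f : T -> T1) : Prop :=
  forall x y, adj x y -> adj1 (f x) (f y).

Definition graph_aut (T : finType) (adj : rel T) (f : T -> T) :=
  graph_hom adj adj f /\ bijective f.

Definition graph_core (T : finType) (adj : rel T) : Prop :=
  forall f : T -> T, graph_hom adj adj f -> graph_aut adj f.

(* The symbols 0 and 1 are false and true. When n = 0 the default value of    *)
(* head is harmless, as the occurrence conditions then fail.                  *)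
Definition QI3_string (n : nat) (v : n.-tuple bool) : bool :=
  [&& head false v == false, 4 <= count_mem false v & 4 <= count_mem true v].

Definition QI3 (n : nat) : finType := {v : n.-tuple bool | QI3_string v}.

Definition qual_indep3 (n : nat) (v1 v2 v3 : n.-tuple bool) : bool :=
  [forall g1 : bool, forall g2 : bool, forall g3 : bool, exists j : 'I_n,
    [&& tnth v1 j == g1, tnth v2 j == g2 & tnth v3 j == g3]].

Definition QI3_edges (n : nat) : {set {set QI3 n}} :=
  [set e : {set QI3 n} | [exists v1 : QI3 n, exists v2 : QI3 n,
    exists v3 : QI3 n,
    (e == [set v1; v2; v3]) && qual_indep3 (val v1) (val v2) (val v3)]].

Definition almost_uniform (n : nat) (v : n.-tuple bool) : bool :=
  [exists b : bool,
    (count_mem b v == n.-1./2) && (count_mem (~~ b) v == n.+1./2)].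

Definition AUQI3 (n : nat) : finType :=
  {v : QI3 n | almost_uniform (val v)}.

Definition AUQI3_edges (n : nat) : {set {set AUQI3 n}} :=
  induced_edges (QI3_edges n) (fun v => almost_uniform (val v)).

(* [n] is 'I_n, i.e. elements are shifted down by one.                        *)
Definition johnson (n m : nat) : finType := {M : {set 'I_n} | #|M| == m}.

Definition johnson_adj (n m : nat) (I : pred nat) : rel (johnson n m) :=
  fun M M' => I #|val M :&: val M'|.
Arguments johnson_adj : clear implicits.

Lemma johnson_adj_sym n m I : symmetric (johnson_adj n m I).
Proof. by move=> M M'; rewrite /johnson_adj setIC. Qed.

Lemma johnson_adj_irr n m (I : pred nat) : ~~ I m ->
  irreflexive (johnson_adj n m I).
Proof.
by move=> Im M; rewrite /johnson_adj setIid (eqP (valP M)); apply: negbTE.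
Qed.

Lemma card_qual_indep3 n (v1 v2 v3 : QI3 n) :
  qual_indep3 (val v1) (val v2) (val v3) -> #|[set v1; v2; v3]| = 3.
Proof.
move=> /forallP h; have h' g1 g2 g3 : exists j,
    [&& tnth (val v1) j == g1, tnth (val v2) j == g2 & tnth (val v3) j == g3].
  by move: (h g1) => /forallP/(_ g2)/forallP/(_ g3)/existsP.
have n12 : v1 != v2.
  have [j /and3P[/eqP e1 /eqP e2 _]] := h' true false true.
  by apply: contra_eqN e1 => /eqP->; rewrite e2.
have n13 : v1 != v3.
  have [j /and3P[/eqP e1 _ /eqP e2]] := h' true false false.
  by apply: contra_eqN e1 => /eqP->; rewrite e2.
have n23 : v2 != v3.
  have [j /and3P[_ /eqP e1 /eqP e2]] := h' true true false.
  by apply: contra_eqN e1 => /eqP->; rewrite e2.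
by rewrite setUC cardsU1 !inE negb_or ![v3 == _]eq_sym n13 n23 cards2 n12.
Qed.

Lemma exists_residue4 c (a b : bool) :
  exists2 i, c <= i < c + 4 & (odd i == a) && (odd i./2 == b).
Proof.
elim: c => [|c [i /andP[ci ic] iab]].
  by case: a; case: b; [exists 3 | exists 1 | exists 2 | exists 0].
case: (ltngtP c i) ci => // [lt_ci | eq_ci] _.
  by exists i => //; rewrite lt_ci addSn ltnS ltnW.
exists (c + 4); first by rewrite addSn leqnn andbT -addn1 leq_add2l.
by rewrite eq_ci addnC /= !negbK.
Qed.

Lemma count_odd_iota k : count odd (iota 0 k.*2.+1) = k.
Proof.
elim: k => // k IH; rewrite doubleS -[_.+3]addn2 iotaD count_cat IH /=.
by rewrite odd_double /= addn1.
Qed.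

Lemma count_odd_half_iota k : count (odd \o half) (iota 0 k.*2.+1) = k.
Proof.
elim: k => // k IH; rewrite doubleS -[_.+3]addn2 iotaD count_cat IH /=.
by rewrite uphalf_double doubleK /=; case: (odd k); rewrite /= addn1.
Qed.

(* Every almost uniform t lies in a hyperedge: list the positions of the 0s   *)
(* of t, then those of its 1s, and colour the i-th position of that list by   *)
(* the parities of i and of i./2; four consecutive positions then show all    *)
(* four colour pairs. Both colourings are complemented, if need be, so that   *)
(* they start with 0.                                                         *)
Section Cover.
Variables (k : nat) (k_ge4 : 4 <= k).
Let n := k.*2.+1.
Variable t : n.-tuple bool.
Hypotheses (t0 : 4 <= count_mem false t) (t1 : 4 <= count_mem true t).

Let s : seq 'I_n :=
  [seq j <- enum 'I_n | tnth t j == false] ++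
  [seq j <- enum 'I_n | tnth t j == true].

Let perm_s : perm_eq s (enum 'I_n).
Proof.
rewrite perm_sym -(perm_filterC (fun j => tnth t j == false) (enum 'I_n)).
by rewrite perm_cat2l; apply/permP => a; congr count; apply: eq_filter => j /=;
  case: (tnth t j).
Qed.

Let uniq_s : uniq s. Proof. by rewrite (perm_uniq perm_s) enum_uniq. Qed.

Let size_s : size s = n. Proof. by rewrite (perm_size perm_s) size_enum_ord. Qed.

Let count_tnth (v : n.-tuple bool) b :
  count_mem b v = count (fun j => tnth v j == b) (enum 'I_n).
Proof. by rewrite -[in LHS](map_tnth_enum v) count_map. Qed.

Let tnth_s i : i < n -> tnth t (nth ord0 s i) = (count_mem false t <= i).
Proof.
move=> lt_in; rewrite nth_cat size_filter -count_tnth.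
have nth0 b i' : i' < count_mem b t ->
    tnth t (nth ord0 [seq j <- enum 'I_n | tnth t j == b] i') = b.
  rewrite count_tnth -size_filter => /(mem_nth ord0).
  by rewrite mem_filter => /andP[/eqP].
case: ltnP => [/nth0 // | le_i]; apply: nth0.
by rewrite ltn_subLR // !count_tnth -!size_filter -size_cat size_s.
Qed.

Let mkw (F : pred nat) : n.-tuple bool :=
  [tuple F (index j s) (+) F (index ord0 s) | j < n].

Let mkwP F : count F (iota 0 n) = k ->
  QI3_string (mkw F) && almost_uniform (mkw F).
Proof.
move=> cF; set c := F (index ord0 s).
have cw b : count_mem b (mkw F) = count (fun i => F i (+) c == b) (iota 0 n).
  rewrite count_tnth -(permP perm_s) -[X in count _ X](mkseq_nth ord0).
  rewrite /mkseq count_map size_s; apply: eq_in_count => i.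
  by rewrite mem_iota add0n /= => lt_in; rewrite tnth_mktuple index_uniq ?size_s.
have c1 : count_mem (~~ c) (mkw F) = k.
  by rewrite cw -[RHS]cF; apply: eq_count => i; case: (F i); case: (c).
have c0 : count_mem c (mkw F) = k.+1.
  apply/eqP; rewrite cw -(eqn_add2l k) -[in X in X == _]cF.
  have /eq_count-> : (fun i => F i (+) c == c) =1 predC F.
    by move=> i /=; case: (F i); case: (c).
  by rewrite count_predC size_iota addnS addnn.
have ge4 b : 4 <= count_mem b (mkw F).
  have [->|ne_bc] := eqVneq b c; first by rewrite c0 leqW.
  by have -> : b = ~~ c; [case: b (c) ne_bc => [] [] | rewrite c1].
apply/andP; split.
  apply/and3P; split.
  - have -> : head false (mkw F) = tnth (mkw F) ord0.
      by rewrite (tnth_nth false) nth0.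
    by rewrite tnth_mktuple addbb.
  - exact: ge4.
  - exact: ge4.
by apply/existsP; exists (~~ c); rewrite negbK c1 c0 -doubleS !doubleK !eqxx.
Qed.

Lemma AUQI3_cover : exists w2 w3 : n.-tuple bool,
  [/\ QI3_string w2 && almost_uniform w2, QI3_string w3 && almost_uniform w3
    & qual_indep3 t w2 w3].
Proof.
exists (mkw odd), (mkw (odd \o half)); split.
- exact/mkwP/count_odd_iota.
- exact/mkwP/count_odd_half_iota.
apply/forallP => g1; apply/forallP => g2; apply/forallP => g3.
set c2 := odd (index ord0 s); set c3 := odd (index ord0 s)./2.
have ct : count_mem false t + count_mem true t = n.
  by rewrite !count_tnth -!size_filter -size_cat size_s.
have [i /andP[ci ic] /andP[/eqP i2 /eqP i3]] :=
  exists_residue4 (if g1 then count_mem false t else 0) (g2 (+) c2) (g3 (+) c3).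
have lt_in : i < n.
  apply: leq_trans ic (leq_trans _ (eq_leq ct)).
  case: (g1); first by rewrite leq_add2l.
  by rewrite add0n (leq_trans t0) // leq_addr.
apply/existsP; exists (nth ord0 s i); rewrite tnth_s // !tnth_mktuple.
rewrite index_uniq ?size_s //= i2 i3 !addbK !eqxx !andbT.
case: (g1) ci ic => [-> // | _]; rewrite add0n => lt_i4.
by rewrite leqNgt (leq_trans lt_i4 t0).
Qed.

End Cover.

Lemma AUQI3_is_hypergraph n : 9 <= n -> odd n -> is_hypergraph (AUQI3_edges n).
Proof.
move=> n9 oddn; split.
  rewrite !inE imset0; apply/negP => /existsP[v1] /existsP[v2] /existsP[v3].
  by case/andP=> /eqP/setP/(_ v1); rewrite !inE eqxx.
apply/setP => v; rewrite inE; apply/bigcupP.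
have En : n = n./2.*2.+1 by rewrite -{1}(odd_double_half n) oddn.
have k4 : 4 <= n./2 by rewrite (half_leq n9).
move: n./2 k4 En => k k4 En; subst n.
have [_ t0 t1] := and3P (valP (val v)).
have [w2 [w3 [/andP[q2 a2] /andP[q3 a3] ind]]] := AUQI3_cover k4 t0 t1.
pose v2 : AUQI3 _ := Sub (Sub w2 q2 : QI3 _) a2.
pose v3 : AUQI3 _ := Sub (Sub w3 q3 : QI3 _) a3.
exists [set v; v2; v3]; last by rewrite !inE eqxx.
rewrite !inE; apply/existsP; exists (val v); apply/existsP; exists (val v2).
apply/existsP; exists (val v3); rewrite ind andbT.
by rewrite !imsetU !imset_set1.
Qed.

(* Main.v *)
Require Import Defs.
From mathcomp Require Import all_boot.

Set Implicit Arguments.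
Unset Strict Implicit.
Unset Printing Implicit Defensive.

(** Write n = 2k + 1. A vertex of 3-AUQI(n,2) is a partition of [n] into parts
    of sizes k and k + 1, hence is determined by its k-part, a vertex of
    J(n,k). The idea is that J(n,k)_I is the 2-section of 3-AUQI(n,2): two
    k-sets M and M' satisfy 2 <= |M :&: M'| <= k - 2 exactly when their
    partitions are distinct and share a hyperedge ([two_section_AUQI3]).

    Both conditions say that the four intersections of a part of one
    partition with a part of the other have at least two elements: these
    sizes are i, k - i, k - i and i + 1 for i = |M :&: M'|
    ([johnson_adj_fibers]). A third partition that completes a hyperedge
    splits each of the four intersections, so two elements in each are
    necessary ([qual_indep3_fibers]); conversely, when each has two elements,
    one of them can be put in a k-set C and the other outside of it, since
    4 <= k <= n - 4 ([splitting_set]).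

    A homomorphism of hypergraphs is injective on hyperedges, so it is a
    homomorphism of the 2-sections ([two_section_hom]). An endomorphism of
    3-AUQI(n,2) is therefore an endomorphism of J(n,k)_I, which is bijective
    when that graph is a core. *)

(** * The 2-section of a hypergraph *)

Definition two_section (T : finType) (E : {set {set T}}) : rel T :=
  fun x y => (x != y) && [exists e in E, (x \in e) && (y \in e)].

Lemma two_section_hom (T T1 : finType) (E : {set {set T}})
    (E1 : {set {set T1}}) (f : T -> T1) :
  hypergraph_hom E E1 f -> graph_hom (two_section E) (two_section E1) f.
Proof.
move=> f_hom x y /andP[ne_xy /exists_inP[e Ee /andP[ex ey]]].
have [e' [E1e' /subsetP sub /eqP/imset_injP f_inj]] := f_hom e Ee.
apply/andP; split; first by apply: contra ne_xy => /eqP/f_inj->.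
by apply/exists_inP; exists e'; rewrite ?sub ?imset_f.
Qed.

(** * Splitting every fiber of a map by a set of prescribed size *)

Lemma subset_of_card_between (T : finType) (A B : {set T}) k :
  A \subset B -> #|A| <= k <= #|B| ->
  exists2 C : {set T}, #|C| = k & (A \subset C) && (C \subset B).
Proof.
move=> sAB /andP[leAk lekB].
pose s := take (k - #|A|) (enum (B :\: A)).
have s_mem j : j \in s -> j \in B :\: A by move/mem_take; rewrite mem_enum.
exists (A :|: [set j in s]); last first.
  rewrite subsetUl subUset sAB /=.
  by apply/subsetP => j; rewrite inE => /s_mem /setDP[].
rewrite cardsU; have -> : A :&: [set j in s] = set0.
  apply/setP => j; rewrite !inE; apply/negP => /andP[Aj /s_mem].
  by rewrite inE Aj.
rewrite cards0 subn0 cardsE (card_uniqP _) ?take_uniq ?enum_uniq //.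
rewrite size_takel ?subnKC // -cardE cardsD (setIidPr sAB).
exact: leq_sub2r.
Qed.

(** Choose two elements x q and y q in each fiber: any set that contains all
    the x q and none of the y q splits every fiber, and the bounds on k leave
    room for one of size k. *)
Lemma splitting_set (T Q : finType) (p : T -> Q) k :
  (forall q, 1 < #|[set j | p j == q]|) -> #|Q| <= k -> k + #|Q| <= #|T| ->
  exists2 C : {set T}, #|C| = k &
    forall q b, exists2 j, p j = q & (j \in C) = b.
Proof.
move=> fib leQk lekT.
have /fin_all_exists[xy xyP] q :
    exists xy : T * T, [/\ p xy.1 = q, p xy.2 = q & xy.1 != xy.2].
  have /card_gt1P[x [y [+ + ne_xy]]] := fib q.
  by rewrite !inE => /eqP px /eqP py; exists (x, y).
pose X := [set (xy q).1 | q : Q]; pose Y := [set (xy q).2 | q : Q].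
have sXY : X \subset ~: Y.
  apply/subsetP => _ /imsetP[q _ ->]; rewrite inE; apply/imsetP => -[r _ eq_qr].
  have [[pq _ ne_q] [_ pr _]] := (xyP q, xyP r).
  have Eqr : q = r by rewrite -pq -pr eq_qr.
  by rewrite -Eqr in eq_qr; rewrite eq_qr eqxx in ne_q.
have leX : #|X| <= k by apply: leq_trans (leq_imset_card _ _) leQk.
have leY : k <= #|~: Y|.
  rewrite -(leq_add2r #|Y|) [#|~: Y| + _]addnC cardsC.
  by apply: leq_trans lekT; rewrite leq_add2l leq_imset_card.
have [||C cardC /andP[/subsetP sXC /subsetP sCY]] :=
  @subset_of_card_between _ X (~: Y) k; [by [] | by rewrite leX |].
exists C => // q b; have [pq1 pq2 _] := xyP q; case: b.
  by exists (xy q).1 => //; apply: sXC; apply: imset_f.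
exists (xy q).2 => //; apply/negP => /sCY.
by rewrite inE => /negP[]; apply: imset_f.
Qed.

(** * Qualitatively independent strings *)

Lemma qual_indep3P n (v1 v2 v3 : n.-tuple bool) :
  reflect (forall g1 g2 g3, exists j,
             [/\ tnth v1 j = g1, tnth v2 j = g2 & tnth v3 j = g3])
          (qual_indep3 v1 v2 v3).
Proof.
apply: (iffP forallP) => [h g1 g2 g3 | h g1].
  move: (h g1) => /forallP/(_ g2)/forallP/(_ g3)/existsP[j].
  by case/and3P=> /eqP ? /eqP ? /eqP ?; exists j.
apply/forallP => g2; apply/forallP => g3; apply/existsP.
by have [j [e1 e2 e3]] := h g1 g2 g3; exists j; rewrite e1 e2 e3 !eqxx.
Qed.

Lemma qual_indep3_swap n (v1 v2 v3 : n.-tuple bool) :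
  qual_indep3 v1 v2 v3 -> qual_indep3 v2 v1 v3.
Proof.
move=> /qual_indep3P h; apply/qual_indep3P => g1 g2 g3.
by have [j []] := h g2 g1 g3; exists j.
Qed.

Lemma qual_indep3_rot n (v1 v2 v3 : n.-tuple bool) :
  qual_indep3 v1 v2 v3 -> qual_indep3 v2 v3 v1.
Proof.
move=> /qual_indep3P h; apply/qual_indep3P => g1 g2 g3.
by have [j []] := h g3 g1 g2; exists j.
Qed.

(** The third string takes both values on each fiber of the other two. *)
Lemma qual_indep3_fibers n (v1 v2 v3 : n.-tuple bool) q :
  qual_indep3 v1 v2 v3 -> 1 < #|[set j | (tnth v1 j, tnth v2 j) == q]|.
Proof.
case: q => a b /qual_indep3P h.
have [[i [i1 i2 i3]] [j [j1 j2 j3]]] := (h a b true, h a b false).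
apply/card_gt1P; exists i, j; split; rewrite ?inE ?i1 ?i2 ?j1 ?j2 //.
by apply: contra_eqN i3 => /eqP->; rewrite j3.
Qed.

Lemma QI3_edge_fibers n (e : {set QI3 n}) (v w : QI3 n) q :
  e \in QI3_edges n -> v \in e -> w \in e -> v != w ->
  1 < #|[set j | (tnth (val v) j, tnth (val w) j) == q]|.
Proof.
rewrite inE => /existsP[v1 /existsP[v2 /existsP[v3 /andP[/eqP-> ind]]]].
have rot := qual_indep3_rot ind; have rot2 := qual_indep3_rot rot.
rewrite !inE -!orbA => /or3P[] /eqP-> /or3P[] /eqP->; rewrite ?eqxx // => _.
- exact: qual_indep3_fibers ind.
- exact: qual_indep3_fibers (qual_indep3_swap rot2).
- exact: qual_indep3_fibers (qual_indep3_swap ind).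
- exact: qual_indep3_fibers rot.
- exact: qual_indep3_fibers rot2.
- exact: qual_indep3_fibers (qual_indep3_swap rot).
Qed.

Lemma count_mem_tnth n (v : n.-tuple bool) b :
  count_mem b v = #|[set j | tnth v j == b]|.
Proof.
rewrite -[in LHS](map_tnth_enum v) count_map cardsE cardE -size_filter.
by rewrite {2}/enum_mem -enumT.
Qed.

(** * Almost uniform partitions as k-sets *)

Section Identification.

Variables (k : nat) (k_ge4 : 4 <= k).
Local Notation n := k.*2.+1.
Local Notation adjJ := (johnson_adj n k [pred i | 2 <= i <= k - 2]).

Implicit Types (M : johnson n k) (v : AUQI3 n).

Lemma johnson_card M : #|val M| = k.
Proof. exact/eqP/(valP M). Qed.

(** The fibers over (a, b) are the four intersections of parts. The one
    outside both k-sets has i + 1 elements, for i the size of the common part,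
    because the ground set has 2k + 1; it is thus never the smallest one. *)
Lemma johnson_adj_fibers M M' :
  reflect (forall q, 1 < #|[set j | (j \in val M, j \in val M') == q]|)
          (adjJ M M').
Proof.
rewrite /johnson_adj /=; set i := #|_ :&: _|.
have le2k : 2 <= k by apply: leq_trans k_ge4.
have leik : i <= k.
  by have := subset_leq_card (subsetIl (val M) (val M')); rewrite johnson_card.
have fib a b : #|[set j | (j \in val M, j \in val M') == (a, b)]| =
    if a then (if b then i else k - i) else (if b then k - i else i.+1).
  case: a b => [] [].
  - by apply: eq_card => j; rewrite !inE xpair_eqE !eqb_id.
  - rewrite -[in RHS](johnson_card M) -cardsD; apply: eq_card => j.
    by rewrite !inE xpair_eqE eqb_id eqbF_neg andbC.
  - rewrite -[in RHS](johnson_card M') /i setIC -cardsD; apply: eq_card => j.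
    by rewrite !inE xpair_eqE eqb_id eqbF_neg.
  have -> : [set j | (j \in val M, j \in val M') == (false, false)] =
      ~: (val M :|: val M').
    by apply/setP => j; rewrite !inE xpair_eqE !eqbF_neg negb_or.
  rewrite cardsCs setCK card_ord cardsU !johnson_card -/i addnn.
  rewrite subSn ?leq_subr //.
  by rewrite subKn // -addnn (leq_trans leik) ?leq_addr.
have ltE : (1 < k - i) = (i <= k - 2) by rewrite !leq_subRL // addnC.
apply: (iffP andP) => [[lt1i lei] [a b] | h].
  by rewrite fib; case: a b => [] []; rewrite ?ltE // ltnW.
by split; [have := h (true, true) | have := h (true, false)]; rewrite fib ?ltE.
Qed.

(** The xor complements the string when needed to make its first entry 0. *)
Definition string_of_set (M : {set 'I_n}) : n.-tuple bool :=
  [tuple (j \in M) (+) (ord0 \in M) | j < n].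

Lemma tnth_string_of_set (M : {set 'I_n}) j :
  tnth (string_of_set M) j = (j \in M) (+) (ord0 \in M).
Proof. exact: tnth_mktuple. Qed.

Lemma count_string_of_set M b :
  count_mem b (string_of_set (val M)) =
    if b (+) (ord0 \in val M) then k else k.+1.
Proof.
rewrite count_mem_tnth; set c := ord0 \in _.
have -> : [set j | tnth (string_of_set (val M)) j == b] =
    if b (+) c then val M else ~: val M.
  apply/setP => j; rewrite inE tnth_string_of_set -/c.
  by case: (b) (c) => [] []; rewrite /= ?inE; case: (j \in val M).
case: (b (+) c); first exact: johnson_card.
by rewrite cardsCs setCK card_ord johnson_card -addnn -addSn addnK.
Qed.

Lemma string_of_set_QI3 M : QI3_string (string_of_set (val M)).
Proof.
have ge4 b : 4 <= count_mem b (string_of_set (val M)).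
  by rewrite count_string_of_set; case: ifP => // _; apply: leqW.
rewrite /QI3_string !ge4 !andbT -nth0.
by rewrite -[nth _ _ _](tnth_nth false _ (ord0 : 'I_n)) tnth_string_of_set addbb.
Qed.

Lemma string_of_set_almost_uniform M :
  almost_uniform (string_of_set (val M)).
Proof.
apply/existsP; exists (~~ (ord0 \in val M)).
by rewrite !count_string_of_set negbK addNb addbb /= doubleK !eqxx.
Qed.

Definition vertex_of_set M : AUQI3 n :=
  Sub (Sub (string_of_set (val M)) (string_of_set_QI3 M) : QI3 n)
      (string_of_set_almost_uniform M).

Lemma tnth_vertex_of_set M j :
  tnth (val (val (vertex_of_set M))) j = (j \in val M) (+) (ord0 \in val M).
Proof. exact: tnth_string_of_set. Qed.

Lemma vertex_of_set_surj v : exists M, vertex_of_set M = v.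
Proof.
have /existsP[b /andP[/eqP cb _]] := valP v.
pose M := [set j | tnth (val (val v)) j == b].
have cardM : #|M| == k by rewrite -count_mem_tnth cb /= doubleK.
exists (Sub M cardM); do 2!apply: val_inj; apply: eq_from_tnth => j.
rewrite tnth_vertex_of_set /= !inE.
have -> : tnth (val (val v)) ord0 = false.
  have /and3P[/eqP h _ _] := valP (val v).
  by rewrite (tnth_nth false) nth0.
by case: (tnth _ _) (b) => [] [].
Qed.

(** * The 2-section of 3-AUQI is the merged Johnson graph *)

Lemma vertex_of_set_edge M M' (C : johnson n k) :
  (forall q b, exists2 j, (j \in val M, j \in val M') = q & (j \in val C) = b) ->
  qual_indep3 (val (val (vertex_of_set M))) (val (val (vertex_of_set M')))
    (val (val (vertex_of_set C))).
Proof.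
move=> split_C; apply/qual_indep3P => g1 g2 g3.
have [j [j1 j2] j3] := split_C
  (g1 (+) (ord0 \in val M), g2 (+) (ord0 \in val M')) (g3 (+) (ord0 \in val C)).
by exists j; rewrite !tnth_vertex_of_set j1 j2 j3 !addbK.
Qed.

Lemma two_section_AUQI3 M M' :
  two_section (AUQI3_edges n) (vertex_of_set M) (vertex_of_set M') = adjJ M M'.
Proof.
apply/idP/johnson_adj_fibers => [|fib].
  case/andP=> ne /exists_inP[e]; rewrite inE => Ee /andP[Me M'e] [a b].
  have := @QI3_edge_fibers n _ (val (vertex_of_set M)) (val (vertex_of_set M'))
    (a (+) (ord0 \in val M), b (+) (ord0 \in val M')) Ee
    (imset_f _ Me) (imset_f _ M'e) ne.
  congr (1 < _); apply: eq_card => j.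
  by rewrite !inE !tnth_vertex_of_set !xpair_eqE !(can_eq (addbK _)).
have [||C0 cardC split_C] := splitting_set (k := k) fib.
- by rewrite card_prod card_bool; exact: k_ge4.
- rewrite card_prod card_bool card_ord -addnn -addnS leq_add2l.
  exact: leqW k_ge4.
move/eqP in cardC; pose C : johnson n k := Sub C0 cardC.
have ind := @vertex_of_set_edge M M' C split_C.
set x := vertex_of_set M in ind *; set y := vertex_of_set M' in ind *.
apply/andP; split.
  apply: contra_eqN (card_qual_indep3 ind) => /eqP->.
  by rewrite setUid cards2; case: (val y != _).
apply/exists_inP; exists [set x; y; vertex_of_set C]; last first.
  by rewrite !inE !eqxx orbT.
rewrite !inE; apply/existsP; exists (val x); apply/existsP; exists (val y).
apply/existsP; exists (val (vertex_of_set C)); rewrite ind andbT.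
by rewrite !imsetU !imset_set1.
Qed.

(** Any right inverse of [vertex_of_set] turns f into a graph endomorphism,
    because [two_section_AUQI3] reflects adjacency as well as preserving it;
    injectivity of that endomorphism passes back to f. *)
Lemma AUQI3_core : graph_core adjJ -> hypergraph_core (AUQI3_edges n).
Proof.
move=> coreJ f f_hom; split=> //; apply: injF_bij.
have /fin_all_exists[set_of set_ofK] := vertex_of_set_surj.
have /coreJ[_ /bij_inj g_inj] :
    graph_hom adjJ adjJ (set_of \o f \o vertex_of_set).
  move=> M M'; rewrite -!two_section_AUQI3 /= !set_ofK.
  exact: two_section_hom.
move=> v w eq_f; rewrite -[v]set_ofK -[w]set_ofK; congr vertex_of_set.
by apply: g_inj; rewrite /= !set_ofK eq_f.
Qed.

End Identification.

Theorem proposition7 (n : nat) (n_ge9 : 9 <= n) (n_odd : odd n) :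
  graph_core (johnson_adj n n.-1./2 [pred i | 2 <= i <= n.-1./2 - 2]) ->
  hypergraph_core (AUQI3_edges n).
Proof.
have k_ge4 : 4 <= n./2 by rewrite (half_leq n_ge9).
have -> : n = n./2.*2.+1 by rewrite -{1}(odd_double_half n) n_odd.
by rewrite /= doubleK; apply: AUQI3_core.
Qed.
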